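(* Let $\mathcal H$ be a real Hilbert space, $A:\mathcal H\rightrightarrows\mathcal H$ a maximal monotone operator, $\theta>0$, $x_0\notin A^{-1}(0)$, and let $(x,\lambda):[0,+\infty[\to\mathcal H\times\mathbb R_{++}$ be the unique global solution of $$\begin{cases}\dot x(t)+x(t)-(I+\lambda(t)A)^{-1}x(t)=0,\quad \lambda(t)>0,\\ \lambda(t)\,\|(I+\lambda(t)A)^{-1}x(t)-x(t)\|=\theta,\\ x(0)=x_0.\end{cases}$$ For $t\ge0$ define $$y(t)=(I+\lambda(t)A)^{-1}x(t),\qquad v(t)=\frac1{\lambda(t)}(x(t)-y(t)),\qquad \tau(t)=\int_0^t\frac{\lambda(u)+\dot\lambda(u)}{\lambda(u)}\,du,$$ and define $\tilde y,\tilde v$ on $[0,+\infty[$ by $y(t)=\tilde y(\tau(t))$, $v(t)=\tilde v(\tau(t))$. Then $(\tilde y,\tilde v)$ is a solution of the regularized Newton system $$\begin{cases}\tilde v\in A\tilde y,\\[2pt] \dfrac1{\lambda\circ\tau^{-1}}\dfrac{d}{d\tau}\tilde y+\dfrac{d}{d\tau}\tilde v+\tilde v=0,\end{cases}$$ where the differential equation holds for almost every $\tau\ge0$.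
   Context: $A^{-1}(0)=\{x\in\mathcal H:0\in Ax\}$. The global solution $(x,\lambda)$ exists and is unique, $x$ is $\mathscr C^1$, and $\lambda$ is locally Lipschitz continuous with $0\le\dot\lambda(t)\le\lambda(t)$ for almost every $t\ge0$; hence $t\le\tau(t)\le2t$ and $\tau$ is an increasing bijection of $[0,+\infty[$ onto itself, with inverse $\tau^{-1}$. The functions $y$ and $v$ are locally Lipschitz continuous. *)

(* Defs.v *)
From HB Require Import structures.
From mathcomp Require Import all_boot all_order all_algebra.
From mathcomp Require Import all_classical all_reals all_analysis.

Set Implicit Arguments.
Unset Strict Implicit.
Unset Printing Implicit Defensive.

Import Order.TTheory GRing.Theory Num.Theory.
Import numFieldNormedType.Exports.

Local Open Scope classical_set_scope.
Local Open Scope ring_scope.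

(* A real Hilbert space is a complete normed module [H] over [R : realType]
   together with a (symmetric, positive definite) form [dot] that induces
   the norm. *)
Definition induces_norm (R : realType) (H : completeNormedModType R)
    (dot : {dot H for @idfun R}) : Prop :=
  forall u : H, `|u| ^+ 2 = dot u u.

Section Operators.
Variables (R : realType) (H : completeNormedModType R).
Implicit Types (A B : H -> set H) (a : R).

(* A set-valued operator is a map [H -> set H]; [A x u] reads "u is in A x". *)

Definition op_id : H -> set H := fun x => [set x].

Definition op_add A B : H -> set H :=
  fun x => [set w | exists u v, [/\ A x u, B x v & w = u + v]].

Definition op_scale a A : H -> set H := fun x => [set a *: u | u in A x].

Definition op_inv A : H -> set H := fun z => [set x | A x z].

Definition monotone (dot : {dot H for @idfun R}) A : Prop :=
  forall x u y v, A x u -> A y v -> 0 <= dot (x - y) (u - v).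

Definition maximal_monotone (dot : {dot H for @idfun R}) A : Prop :=
  monotone dot A /\
  forall B, monotone dot B -> (forall x, A x `<=` B x) -> B = A.

Definition resolvent a A : H -> set H :=
  op_inv (op_add op_id (op_scale a A)).

End Operators.

Section HalfLine.
Variables (R : realType) (V : normedModType R).
Implicit Type f : R -> V.

(* [l] is the derivative at [t] of [f] restricted to [0, +oo[; at [t = 0] this
   is the right derivative, and the values of [f] on ]-oo, 0[ play no role. *)
Definition is_derive_halfline f (t : R) (l : V) : Prop :=
  (fun s : R => (s - t)^-1 *: (f s - f t)) @ within `[0, +oo[ (t^') --> l.

Definition absolutely_continuous_on (a b : R) f : Prop :=
  forall e : R, 0 < e -> exists2 d : R, 0 < d &
    forall (n : nat) (p q : 'I_n -> R),
      (forall i, [/\ a <= p i, p i <= q i & q i <= b]) ->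
      (forall i j, i != j -> q i <= p j \/ q j <= p i) ->
      \sum_(i < n) (q i - p i) < d ->
      \sum_(i < n) `|f (q i) - f (p i)| < e.

Definition locally_absolutely_continuous f : Prop :=
  forall b : R, 0 <= b -> absolutely_continuous_on 0 b f.

End HalfLine.

Section Systems.
Variables (R : realType) (H : completeNormedModType R).

(* Resolvents are set-valued here, so an equality w = (I + lam A)^-1 z between
   points is written [resolvent lam A z = [set w]]. *)
Definition closed_loop_solution (A : H -> set H) (theta : R) (x0 : H)
    (x : R -> H) (lam : R -> R) : Prop :=
  x 0 = x0 /\
  forall t : R, 0 <= t -> 0 < lam t /\
    exists x' w : H,
      [/\ is_derive_halfline x t x',
          resolvent (lam t) A (x t) = [set w],
          x' + x t - w = 0 &
          lam t * `|w - x t| = theta].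

(* [derive1 lam u] is meaningful only at points of differentiability of [lam]. *)
Definition time_rescaling (lam : R -> R) (t : R) : R :=
  \int[lebesgue_measure]_(u in `[0, t]) ((lam u + derive1 lam u) / lam u).

(* The inverse of [time_rescaling lam : [0, +oo[ -> [0, +oo[]. *)
Definition time_rescaling_inv (lam : R -> R) : R -> R :=
  'pinv_(fun=> 0) `[0, +oo[ (time_rescaling lam).

(* Solutions of  v \in A y,  (1 / mu) y' + v' + v = 0  on [0, +oo[, in the
   sense of Caratheodory: the differential equation holds almost everywhere
   and [y], [v] are locally absolutely continuous. *)
Definition regularized_newton_solution (A : H -> set H) (mu : R -> R)
    (y v : R -> H) : Prop :=
  [/\ locally_absolutely_continuous y,
      locally_absolutely_continuous v,
      (forall s : R, 0 <= s -> A (y s) (v s)) &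
      {ae @lebesgue_measure R, forall s : R, 0 <= s ->
        [/\ derivable y s 1, derivable v s 1 &
            (mu s)^-1 *: derive1 y s + derive1 v s + v s = 0]}].

End Systems.

(* Main.v *)
Require Import Defs.
From HB Require Import structures.
From mathcomp Require Import all_boot all_order all_algebra.
From mathcomp Require Import all_classical all_reals all_analysis.
From mathcomp Require Import measurable_realfun ring lra.

(** Put [p = 1 / lam].  Along the trajectory [x = y + (1/p) v] with [v] in [A y],
    and the closed loop condition says [`|v| = theta p^2].  For two such
    decompositions, monotonicity of [A] gives, after expanding the scalar
    product of [x1 - x2] and [v1 - v2], the bounds
      [theta |p1 - p2| <= |x1 - x2|]   and
      [|v1 - v2| <= (p1 + p2) |x1 - x2|],
    so [p] and [v] are Lipschitz functions of [x] ([monotone_pair_dist_p],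
    [monotone_pair_dist_v]).  Since [|x'| = theta p] and [p] is continuous, [x],
    [p], [v] and [y] are Lipschitz on every [[0, b]].  If moreover [x] moves in
    the direction [- lam v] prescribed by the equation, a refinement of the same
    expansion shows that [p] can only decrease to first order
    ([monotone_pair_decrease]); hence [lam] is nondecreasing.

    Since [ln lam] is Lipschitz on bounded intervals,
    [tau t = t + ln (lam t) - ln (lam 0)] ([time_rescalingE]).  As [lam] is
    nondecreasing, [tau] expands distances, so its inverse [T] is 1-Lipschitz and
    [yt = y o T], [vt = v o T] are Lipschitz on bounded intervals.  At a point [s]
    where [yt], [vt] and [T] are all differentiable, write [m = lam o T] and
    differentiate [x o T = yt + m vt]: the chain rule gives [- m vt T'] on the
    left, and [m = lam 0 * exp (s - T s)] gives [m' = m (1 - T')], so that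
    everything collapses to [yt' + m vt' + m vt = 0] ([newton_equation]).

    What remains is the differentiability almost everywhere of Lipschitz maps.
    For a real Lipschitz [f], [f + k x] is the distribution function of a
    Stieltjes measure bounded by [2 k] times Lebesgue measure, and the
    Radon-Nikodym density of this measure is the derivative of [f + k x]
    ([lipschitz_FTC]).  For a curve [gam] in a Hilbert space, countably many
    vectors [w n] of norm at most 1 realize all the norms [|gam q - gam p|] with
    [p], [q] rational, so [|gam t - gam s| <= \int_s^t G] where [G] is the supremum
    of the derivatives of the functions [<gam, w n>].  At a Lebesgue point of [G]
    the difference quotients have norm asymptotically at most [G] while some
    [w n] sees a component nearly equal to [G]; by the parallelogram identity the
    quotients are then Cauchy ([cvg_of_norming], [lipschitz_ae_derivable]). *)

Set Implicit Arguments.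
Unset Strict Implicit.
Unset Printing Implicit Defensive.

Import Order.TTheory GRing.Theory Num.Theory.
Import numFieldNormedType.Exports.

Local Open Scope classical_set_scope.
Local Open Scope ring_scope.

(** * Inner products and pairs of points on the graph of a monotone operator *)

Section InnerProduct.
Variables (R : realType) (H : completeNormedModType R).
Variable dot : {dot H for @idfun R}.
Hypothesis dotE : induces_norm dot.
Implicit Types u v w : H.

Lemma dotC u v : dot u v = dot v u.
Proof. by rewrite hermC expr0 mul1r. Qed.

Lemma dotDl u v w : dot (u + v) w = dot u w + dot v w.
Proof. exact: linearDl. Qed.
Lemma dotBl u v w : dot (u - v) w = dot u w - dot v w.
Proof. exact: linearBl. Qed.
Lemma dotZl (a : R) u w : dot (a *: u) w = a * dot u w.
Proof. exact: linearZl_LR. Qed.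
Lemma dotDr u v w : dot w (u + v) = dot w u + dot w v.
Proof. exact: linearDr. Qed.
Lemma dotBr u v w : dot w (u - v) = dot w u - dot w v.
Proof. exact: linearBr. Qed.
Lemma dotZr (a : R) u w : dot w (a *: u) = a * dot w u.
Proof. exact: linearZr_LR. Qed.

Lemma dotNl u w : dot (- u) w = - dot u w.
Proof. exact: linearNl. Qed.
Lemma dotNr u w : dot w (- u) = - dot w u.
Proof. exact: linearNr. Qed.

Definition dotL := (dotDl, dotNl, dotZl, dotDr, dotNr, dotZr).

Lemma sqr_normD u v : `|u + v| ^+ 2 = `|u| ^+ 2 + 2 * dot u v + `|v| ^+ 2.
Proof. by rewrite !dotE !dotL (dotC v u); ring. Qed.

Lemma sqr_normB u v : `|u - v| ^+ 2 = `|u| ^+ 2 - 2 * dot u v + `|v| ^+ 2.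
Proof. by rewrite !dotE !dotL (dotC v u); ring. Qed.

Lemma dot_le u v : dot u v <= `|u| * `|v|.
Proof.
have [->|u0] := eqVneq u 0; first by rewrite linear0l normr0 mul0r.
have [->|v0] := eqVneq v 0; first by rewrite linear0r normr0 mulr0.
have uv0 : 0 < `|u| * `|v| by rewrite mulr_gt0// normr_gt0.
have := sqr_ge0 `| `|v| *: u - `|u| *: v|.
rewrite sqr_normB !normrZ !normr_id !dotL.
have -> : (`|v| * `|u|) ^+ 2 - 2 * (`|v| * (`|u| * dot u v)) +
  (`|u| * `|v|) ^+ 2 = 2 * (`|u| * `|v|) * (`|u| * `|v| - dot u v) by ring.
have uv20 : 0 < 2 * (`|u| * `|v|) by rewrite mulr_gt0.
by rewrite (pmulr_rge0 _ uv20) subr_ge0.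
Qed.

Lemma cauchy_schwarz u v : `|dot u v| <= `|u| * `|v|.
Proof.
rewrite ler_norml dot_le andbT lerNl -[- dot u v]mulN1r -dotZl.
by rewrite (le_trans (dot_le _ _))// normrZ normrN1 mul1r.
Qed.

Section MonotonePair.
Variables (theta p q : R) (x1 x2 y1 y2 v1 v2 : H).
Hypotheses (theta0 : 0 < theta) (p0 : 0 < p) (q0 : 0 < q).
Hypotheses (x1E : x1 = y1 + p^-1 *: v1) (x2E : x2 = y2 + q^-1 *: v2).
Hypotheses (v1E : `|v1| = theta * p ^+ 2) (v2E : `|v2| = theta * q ^+ 2).
Hypothesis mono : 0 <= dot (y1 - y2) (v1 - v2).

Let P := theta ^+ 2 * p ^+ 2 * q ^+ 2 - dot v1 v2.

Let P_ge0 : 0 <= P.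
Proof.
rewrite /P subr_ge0 (le_trans (dot_le _ _))// v1E v2E.
by rewrite le_eqVlt; apply/orP; left; apply/eqP; ring.
Qed.

Let sqr_v12 : `|v1 - v2| ^+ 2 = theta ^+ 2 * (p ^+ 2 - q ^+ 2) ^+ 2 + 2 * P.
Proof. by rewrite sqr_normB v1E v2E /P; ring. Qed.

Let dot_x12 : theta ^+ 2 * (p ^+ 2 - q ^+ 2) * (p - q) + (p^-1 + q^-1) * P
  <= dot (x1 - x2) (v1 - v2).
Proof.
have -> : x1 - x2 = (y1 - y2) + (p^-1 *: v1 - q^-1 *: v2).
  by rewrite x1E x2E opprD addrACA.
rewrite dotDl; apply: le_trans (lerD mono (lexx _)); rewrite add0r.
rewrite !dotL (dotC v2 v1) -!dotE v1E v2E /P.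
rewrite le_eqVlt; apply/orP; left; apply/eqP; field.
by rewrite !gt_eqF.
Qed.

(** The parameters [p] and [q] are the inverses of the two step sizes.  The
    expansion of [dot (x1 - x2) (v1 - v2)] splits into a radial part, driven by
    the difference of the norms of [v1] and [v2], and an angular part [P >= 0];
    both dominate the corresponding part of [`|v1 - v2| ^+ 2] once multiplied by
    [p + q]. *)
Lemma monotone_pair_dist_v : `|v1 - v2| <= (p + q) * `|x1 - x2|.
Proof.
have pq0 : 0 < p + q by rewrite addr_gt0.
have [->|n0] := eqVneq `|v1 - v2| 0; first by rewrite mulr_ge0// ltW.
have d0 : 0 < `|v1 - v2| by rewrite lt_def n0 normr_ge0.
rewrite -(ler_pM2r d0) -expr2 -mulrA.
apply: (@le_trans _ _ ((p + q) * dot (x1 - x2) (v1 - v2))); last first.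
  by rewrite ler_pM2l// dot_le.
apply: le_trans (ler_wpM2l (ltW pq0) dot_x12).
rewrite sqr_v12 [leRHS]mulrDr lerD//.
  by rewrite le_eqVlt; apply/orP; left; apply/eqP; ring.
rewrite mulrA ler_wpM2r//.
have -> : (p + q) * (p^-1 + q^-1) = 2 + (p / q + q / p).
  by field; rewrite !gt_eqF.
by rewrite lerDl addr_ge0// divr_ge0// ltW.
Qed.

Let norm_v12 : theta * `|p - q| * (p + q) <= `|v1 - v2|.
Proof.
have pq0 : 0 < p + q by rewrite addr_gt0.
have -> : theta * `|p - q| * (p + q) = `| `|v1| - `|v2| |.
  rewrite v1E v2E -mulrBr normrM (gtr0_norm theta0) -mulrA; congr (_ * _).
  by rewrite subr_sqr normrM (gtr0_norm pq0).
exact: ler_dist_dist.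
Qed.

(** The norms of [v1] and [v2] differ by [theta * (p - q) * (p + q)], so the bound
    on [v1 - v2] loses exactly the factor [p + q]. *)
Lemma monotone_pair_dist_p : theta * `|p - q| <= `|x1 - x2|.
Proof.
have pq0 : 0 < p + q by rewrite addr_gt0.
by rewrite -(ler_pM2r pq0) (le_trans norm_v12)// mulrC monotone_pair_dist_v.
Qed.

(** An explicit Euler step of relative length [h] along [- v1 / p] can increase
    [p] by no more than a multiple of the error [r]: for [p < q] the radial part
    of the step is negative and its angular part is absorbed because [h <= 1],
    so only [r] is left to balance the positive terms. *)
Lemma monotone_pair_decrease (h : R) r : 0 <= h <= 1 ->
  x1 - x2 = (h / p) *: v1 + r -> theta * (q - p) <= 2 * `|r|.
Proof.
move=> /andP[h0 h1] x12; have pq0 : 0 < p + q by rewrite addr_gt0.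
have [qp|pq] := leP q p.
  by rewrite (@le_trans _ _ 0)// ?mulr_ge0// pmulr_rle0// subr_le0.
suff key : `|v1 - v2| <= 2 * q * `|r|.
  have := le_trans norm_v12 key.
  rewrite distrC gtr0_norm ?subr_gt0// => th.
  rewrite -(ler_pM2r q0) (@le_trans _ _ (theta * (q - p) * (p + q)))//.
    by rewrite ler_wpM2l ?lerDr ?mulr_ge0 ?subr_ge0 ?(ltW p0)// ltW.
  by rewrite (le_trans th)// mulrAC.
have [->|n0] := eqVneq `|v1 - v2| 0; first by rewrite !mulr_ge0// ltW.
have d0 : 0 < `|v1 - v2| by rewrite lt_def n0 normr_ge0.
rewrite -(ler_pM2r d0) -expr2.
have q20 : 0 < 2 * q by rewrite mulr_gt0.
apply: (@le_trans _ _ ((2 * q) * dot r (v1 - v2))); last first.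
  by rewrite -[leRHS]mulrA (ler_pM2l q20) dot_le.
have := dot_x12; rewrite x12 dotDl dotZl.
have -> : dot v1 (v1 - v2) = theta ^+ 2 * p ^+ 2 * (p ^+ 2 - q ^+ 2) + P.
  by rewrite dotBr -dotE v1E /P; ring.
rewrite -lerBlDl => le1.
apply: le_trans (ler_wpM2l (ltW q20) le1).
rewrite sqr_v12 -subr_ge0.
set e := q - p; have e0 : 0 < e by rewrite subr_gt0.
(* both summands on the right-hand side are visibly nonnegative *)
have -> : 2 * q * (theta ^+ 2 * (p ^+ 2 - q ^+ 2) * (p - q) +
    (p^-1 + q^-1) * P -
    h / p * (theta ^+ 2 * p ^+ 2 * (p ^+ 2 - q ^+ 2) + P)) -
    (theta ^+ 2 * (p ^+ 2 - q ^+ 2) ^+ 2 + 2 * P) =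
  theta ^+ 2 * (p + q) * e * (e ^+ 2 + 2 * q * h * p) +
  2 * q * (1 - h) / p * P.
  by rewrite /e; field; rewrite !gt_eqF.
have : 0 <= 1 - h by rewrite subr_ge0.
move: (1 - h) P P_ge0 => k S S0 k0.
have [p0w q0w] := (ltW p0, ltW q0); have [e0w t0w] := (ltW e0, ltW theta0).
clearbody e.
by apply: addr_ge0; rewrite ?(divr_ge0, mulr_ge0, addr_ge0, sqr_ge0).
Qed.

End MonotonePair.
End InnerProduct.

(** * Real Lipschitz functions are integrals of their derivatives *)

Section RealLipschitz.
Variable R : realType.
Notation mu := (@lebesgue_measure R).

#[global] Instance lebesgue_ae_filter :
  Filter (nbhs (almost_everywhere (@lebesgue_measure R))).
Proof. exact: ae_filter_ringOfSetsType. Qed.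

Lemma Rintegral_ae_eq (D : set R) (f g : R -> R) : measurable D ->
  measurable_fun D f -> measurable_fun D g ->
  {ae mu, forall x, D x -> f x = g x} ->
  \int[mu]_(x in D) f x = \int[mu]_(x in D) g x.
Proof.
move=> mD mf mg fg; congr fine; apply: ae_eq_integral => //.
- exact/measurable_EFinP.
- exact/measurable_EFinP.
- by apply: filterS fg => x /[apply] /= ->.
Qed.

Lemma bounded_itvoc_integrable (f : R -> R) (k c d : R) :
  measurable_fun setT f -> (forall t, `|f t| <= k) ->
  mu.-integrable `]c, d]%classic (EFin \o f).
Proof.
move=> mf fk; apply: measurable_bounded_integrable => //.
- rewrite /= lebesgue_measure_itv/=.
  by case: ifP => // _; rewrite -EFinB ltry.
- exact: measurable_funTS.
- exists k; split; first by rewrite num_real.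
  by move=> M kM t _ /=; rewrite (le_trans (fk t))// ltW.
Qed.

Lemma Rintegral_itvoc_cst (k c d : R) : c <= d ->
  \int[mu]_(u in `]c, d]) k = k * (d - c).
Proof.
move=> cd; rewrite Rintegral_cst//= lebesgue_measure_itv/= lte_fin.
have [_|dc] := ltP c d; first by rewrite -EFinB.
by rewrite (@le_anti _ _ c d) ?cd// subrr.
Qed.

Lemma stieltjes_itvoc (g : cumulative R R) (a b : R) : a <= b ->
  lebesgue_stieltjes_measure g `]a, b]%classic = (g b - g a)%:E.
Proof.
move=> ab; rewrite /lebesgue_stieltjes_measure /measure_extension.
by rewrite measurable_mu_extE/= ?wlength_itv_bnd//; exact: is_ocitv.
Qed.

(** The measures of [g] and [h] add up to [K] times Lebesgue measure, because
    they do so on half-open intervals. *)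
Lemma stieltjes_dominated (g h : cumulative R R) (K : R) : 0 < K ->
  (forall x, g x + h x = K * x) -> lebesgue_stieltjes_measure g `<< mu.
Proof.
move=> K0 gh.
have iK0 : 0 <= K^-1 by rewrite invr_ge0 ltW.
pose m : {measure set (measurableTypeR R) -> \bar R} :=
  mscale (NngNum iK0) (measure_add (lebesgue_stieltjes_measure g)
                                   (lebesgue_stieltjes_measure h)).
have mE A : m A = (K^-1%:E * (lebesgue_stieltjes_measure g A +
    lebesgue_stieltjes_measure h A))%E by rewrite -measure_addE.
have muE A : measurable A -> mu A = m A.
  apply: lebesgue_measure_unique => X /ocitvP[->|[[a b] /= ab ->]].
    by rewrite !measure0.
  rewrite mE !stieltjes_itvoc ?(ltW ab)// lebesgue_measure_itv/= lte_fin ab.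
  rewrite -EFinD -EFinM; congr EFin.
  have -> : g b - g a + (h b - h a) = (g b + h b) - (g a + h a) by ring.
  by rewrite !gh; field; rewrite gt_eqF.
apply/null_content_dominatesP => A mA A0.
have /eqP : m A = 0 by rewrite -muE.
rewrite mE mule_eq0 eqe invr_eq0 gt_eqF//=.
by rewrite padde_eq0 ?measure_ge0// => /andP[/eqP].
Qed.

Lemma stieltjes_density (g h : cumulative R R) (K a b : R) : 0 < K -> a < b ->
  (forall x, g x + h x = K * x) ->
  exists2 F : R -> R, mu.-integrable setT (EFin \o F) &
    forall x, a <= x <= b -> g x - g a = \int[mu]_(t in `]a, x]) F t.
Proof.
move=> K0 ab gh.
have mD : measurable (`]a, b]%classic : set (measurableTypeR R)) by [].
have nuD : (lebesgue_stieltjes_measure g `]a, b]%classic < +oo)%E.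
  by rewrite stieltjes_itvoc ?ltW// ltry.
pose nu : {finite_measure set _ -> \bar R} := mfrestr mD nuD.
have numu : nu `<< mu.
  apply/null_content_dominatesP => A mA A0.
  have /null_content_dominatesP := stieltjes_dominated K0 gh.
  apply; first exact: measurableI.
  apply/eqP; rewrite eq_le measure_ge0 andbT -A0.
  by rewrite le_measure ?inE//; exact: measurableI.
have [F [F0 Ffin Fint FE]] := radon_nikodym_sigma_finite numu.
have FK : EFin \o (fine \o F) = F by apply/funext => x /=; rewrite fineK.
exists (fine \o F); first by rewrite FK.
move=> x /andP[ax xb].
rewrite /Rintegral.
under eq_integral do rewrite fineK//.
rewrite -FE// /nu /= /mfrestr /mrestr.
rewrite (_ : _ `&` _ = `]a, x]%classic) ?stieltjes_itvoc//.
apply/seteqP; split=> y /=; rewrite !in_itv/=; first by case.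
by move=> /andP[ay yx]; rewrite ay yx (le_trans yx xb).
Qed.

Definition lipschitz_real (V : normedModType R) (k : R) (f : R -> V) :=
  forall x y, `|f x - f y| <= k * `|x - y|.

Lemma lipschitz_real_continuous (V : normedModType R) (k : R) (f : R -> V) :
  0 < k -> lipschitz_real k f -> continuous f.
Proof.
move=> k0 fL x; apply/cvgrPdist_le => e e0.
have : \forall y \near x, `|x - y| <= e / k.
  apply/nbhs_ballP; exists (e / k); first by rewrite /= divr_gt0.
  by move=> y /ltW.
apply: filterS => y xy; rewrite (le_trans (fL _ _))//.
by rewrite mulrC -ler_pdivlMr.
Qed.

Section FTC.
Variables (f : R -> R) (k a b : R).
Hypotheses (k0 : 0 < k) (fL : lipschitz_real k f) (ab : a < b).

Lemma derive1_lipschitz x : derivable f x 1 -> `|derive1 f x| <= k.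
Proof.
move=> df; rewrite derive1E.
have /cvg_norm dfn := df; apply: (cvgr_to_le dfn).
near=> h.
have h0 : h != 0 by near: h; exact: nbhs_dnbhs_neq.
rewrite normrZ/= normfV ler_pdivrMl ?normr_gt0//.
by rewrite (le_trans (fL _ _))// scaler1 addrK mulrC.
Unshelve. all: by end_near. Qed.

(** The density is clipped to [[-k, k]], which changes it on a null set only, so
    that suprema of families of such densities stay finite. *)
Lemma lipschitz_FTC : exists phi : R -> R,
  [/\ measurable_fun setT phi, forall x, `|phi x| <= k,
    {ae mu, forall x, a < x <= b -> derivable f x 1 /\ derive1 f x = phi x} &
    forall x, a <= x <= b -> f x - f a = \int[mu]_(t in `]a, x]) phi t].
Proof.
have fB x y : x <= y -> `|f y - f x| <= k * (y - x).
  by move=> xy; rewrite (le_trans (fL _ _))// ger0_norm// subr_ge0.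
pose g x := k * x + f x; pose h x := k * x - f x.
have gnd : {homo g : x y / x <= y}.
  move=> x y xy; have := fB _ _ xy; rewrite ler_norml => /andP[].
  by rewrite /g; lra.
have hnd : {homo h : x y / x <= y}.
  move=> x y xy; have := fB _ _ xy; rewrite ler_norml => /andP[].
  by rewrite /h; lra.
have fc := lipschitz_real_continuous k0 fL.
have kc : continuous (fun x : R => k * x).
  by move=> x; apply: cvgM; [exact: cvg_cst|exact: cvg_id].
have gc : continuous g by move=> x; apply: cvgD; [exact: kc|exact: fc].
have hc : continuous h by move=> x; apply: cvgB; [exact: kc|exact: fc].
pose g' : cumulative R R := HB.pack g
  (isCumulative.Build R _ R g gnd (right_continuousW gc)).
pose h' : cumulative R R := HB.pack h
  (isCumulative.Build R _ R h hnd (right_continuousW hc)).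
(* the interval is enlarged to [b + 1] so that [b] becomes an interior point *)
have [|||F Fint gE] := @stieltjes_density g' h' (2 * k) a (b + 1).
- by rewrite mulr_gt0.
- by rewrite (lt_trans ab)// ltrDl ltr01.
- by move=> x /=; rewrite /g /h; ring.
have FintD y : mu.-integrable `]a, y]%classic (EFin \o F).
  by apply: integrableS Fint.
have Floc : locally_integrable setT F.
  by apply: open_integrable_locally => //; exact: openT.
have dF := FTC1 FintD Floc.
have dae : {ae mu, forall x, a < x <= b ->
    derivable f x 1 /\ derive1 f x = F x - k}.
  apply: filterS dF => x + /andP[ax xb] => /(_ _)[|dG GE].
    by rewrite lte_fin.
  set G := (fun x => _) in dG GE.
  have fE : \near x, f x = g a + G x - k * x.
    near=> y.
    have /gE : a <= y <= b + 1.
      apply/andP; split.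
        by apply/ltW; near: y; exact: lt_nbhsr.
      by apply/ltW; near: y; apply: lt_nbhsl; rewrite (le_lt_trans xb)// ltrDl ltr01.
    by rewrite /G /= /g => <-; ring.
  have DE : is_derive x 1 (fun x => g a + G x - k * x) (F x - k).
    have dG' : is_derive x 1 G (F x).
      by apply: DeriveDef; [exact: dG|rewrite -derive1E].
    have -> : F x - k = 0 + F x - k *: 1 by rewrite add0r /GRing.scale/= mulr1.
    exact: (is_deriveB (is_deriveD (is_derive_cst (g a) x 1) dG')
      (is_deriveZ k (is_derive_id x 1))).
  have [] : is_derive x 1 f (F x - k).
    by apply: near_eq_is_derive DE; apply: filterS fE => y ->.
  by move=> df dfE; split; rewrite ?derive1E.
pose clip (x : R) := Num.max (- k) (Num.min k x).
have clip_id (x : R) : `|x| <= k -> clip x = x.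
  rewrite ler_norml => /andP[kx xk].
  by rewrite /clip min_r// max_r.
exists (fun x => clip (F x - k)); split.
- apply: measurable_maxr; first exact: measurable_cst.
  apply: measurable_minr; first exact: measurable_cst.
  apply: measurable_funB; last exact: measurable_cst.
  by apply/measurable_EFinP; exact: (measurable_int mu).
- move=> x; rewrite ler_norml /clip le_max lexx/= ge_max ge_min lexx/= andbT.
  by rewrite (@le_trans _ _ 0) ?oppr_le0// ltW.
- apply: filterS dae => x /[apply] -[df dfE]; split => //.
  by rewrite clip_id -dfE// derive1_lipschitz.
- move=> x /andP[ax xb].
  have -> : f x - f a = (g x - g a) - k * (x - a) by rewrite /g; ring.
  rewrite gE; last by rewrite ax (le_trans xb)// lerDl.
  have -> : k * (x - a) = \int[mu]_(t in `]a, x]) k.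
    by rewrite Rintegral_itvoc_cst.
  have mF D : measurable_fun D F.
    by apply/measurable_funTS/measurable_EFinP; exact: (measurable_int mu).
  rewrite -RintegralB//; last first.
    by apply: (@bounded_itvoc_integrable _ k) => // u; rewrite gtr0_norm.
  apply: Rintegral_ae_eq => //; first exact: measurable_funB.
    apply: measurable_maxr; first exact: measurable_cst.
    apply: measurable_minr; first exact: measurable_cst.
    exact: measurable_funB.
  apply: filterS dae => t dt /=; rewrite in_itv/= => /andP[a_t tx].
  have [|df dfE] := dt; first by rewrite a_t (le_trans tx).
  by rewrite clip_id -dfE// derive1_lipschitz.
Unshelve. all: by end_near. Qed.
End FTC.
End RealLipschitz.

(** * Lipschitz curves in a Hilbert space are differentiable almost everywhere *)

Section HilbertLipschitz.
Variables (R : realType) (H : completeNormedModType R).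
Variable dot : {dot H for @idfun R}.
Hypothesis dotE : induces_norm dot.
Notation mu := (@lebesgue_measure R).

(** If the norms of [D] are eventually at most about [g] and all values have a
    component close to [g] along one common unit vector, then sums [D h0 + D h]
    have norm about [2 g] and the parallelogram identity forces [D h0 - D h] to be
    small. *)
Lemma cvg_of_norming (T : Type) (F : set_system T) (FF : ProperFilter F)
    (D : T -> H) (g : R) :
  (forall e, 0 < e -> \near F, `|D F| <= g + e) ->
  (forall e, 0 < e -> exists w, `|w| <= 1 /\ \near F, g - e <= dot (D F) w) ->
  cvg (D @ F).
Proof.
move=> Dle Dge.
have g0 : 0 <= g.
  apply/ler_addgt0Pr => e e0.
  have [h hg] := filter_ex (Dle _ e0).
  by rewrite (le_trans _ hg).
apply: cauchy_cvg; apply: cauchy_exP => eps eps0.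
(* the parallelogram identity bounds [`|D h0 - D h| ^+ 2] by [16 g e] if
   [e <= g], and by [4 (g + e)^2 <= 16 e] otherwise, as then [g < e <= 1] *)
pose e := Num.min 1 (eps ^+ 2 / (2 * (24 * g + 36))).
have g24 : 0 < 24 * g + 36 by rewrite ltr_wpDl// mulr_ge0.
have e0 : 0 < e.
  by rewrite lt_min ltr01/= divr_gt0 ?mulr_gt0 ?exprn_gt0.
have e1 : e <= 1 by rewrite ge_min lexx.
have e2 : 2 * (e * (24 * g + 36)) <= eps ^+ 2.
  rewrite mulrCA -ler_pdivlMr ?mulr_gt0//.
  by rewrite /e ge_min lexx orbT.
have [w [w1 Dw]] := Dge _ e0.
have S : \forall h \near F, `|D h| <= g + e /\ g - e <= dot (D h) w.
  by apply: filterI => //; exact: Dle.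
have [h0 [h0le h0w]] := filter_ex S.
exists (D h0); apply: filterS S => h /= [hle hw].
rewrite -ball_normE /= -(@ltr_pXn2r _ 2)// ?nnegrE ?(ltW eps0)//.
have sumle : 2 * (g - e) <= `|D h0 + D h|.
  apply: (@le_trans _ _ (dot (D h0 + D h) w)).
    by rewrite dotDl; lra.
  apply: le_trans (dot_le dotE _ _) _.
  by rewrite ler_piMr.
have par : `|D h0 - D h| ^+ 2 =
    2 * `|D h0| ^+ 2 + 2 * `|D h| ^+ 2 - `|D h0 + D h| ^+ 2.
  by rewrite (sqr_normB dotE) (sqr_normD dotE); ring.
have sq (u : H) : `|u| <= g + e -> `|u| ^+ 2 <= (g + e) ^+ 2.
  by move=> ule; rewrite ler_pXn2r// ?nnegrE// addr_ge0// ltW.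
have := sq _ h0le; have := sq _ hle.
rewrite par; set A := `|D h0| ^+ 2; set B := `|D h| ^+ 2 => Ble Ale.
have [eg|ge] := leP e g.
  have Cge : (2 * (g - e)) ^+ 2 <= `|D h0 + D h| ^+ 2.
    by rewrite ler_pXn2r// ?nnegrE// mulr_ge0// subr_ge0.
  have ge0 : 0 <= g * e by rewrite mulr_ge0// ltW.
  have eps20 : 0 < eps ^+ 2 by rewrite exprn_gt0.
  by move: Cge Ble Ale e2; rewrite !expr2 in eps20 *; lra.
have C0 : 0 <= `|D h0 + D h| ^+ 2 by rewrite sqr_ge0.
have eps20 : 0 < eps ^+ 2 by rewrite exprn_gt0.
have : e * g <= e * e by rewrite ler_pM2l// ltW.
have : g * g <= e * g by rewrite ler_wpM2r// ltW.
have : e * e <= e by rewrite ler_piMr// ltW.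
have : 0 <= e * g by rewrite mulr_ge0// ltW.
by move: C0 Ble Ale e2 eps20; rewrite !expr2; lra.
Qed.

Section AeDerivable.
Variables (gam : R -> H) (k a b : R).
Hypotheses (k0 : 0 < k) (gamL : lipschitz_real k gam) (ab : a < b).

(** The normalized increments of [gam] between rational points, enumerated by the
    pickling of pairs of rationals. *)
Let w (n : nat) : H :=
  if unpickle n is Some (p, q) then
    let d := gam (ratr q) - gam (ratr p) in `|d|^-1 *: d
  else 0.

Let w_le1 n : `|w n| <= 1.
Proof.
rewrite /w; case: unpickle => [[p q]|]; last by rewrite normr0.
set d := _ - _; rewrite normrZ normfV normr_id.
have [->|d0] := eqVneq `|d| 0; first by rewrite mulr0.
by rewrite mulVf.
Qed.

Let w_norming (p q : rat) : let n := pickle (p, q) in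
  dot (gam (ratr q)) (w n) - dot (gam (ratr p)) (w n) =
  `|gam (ratr q) - gam (ratr p)|.
Proof.
rewrite /= -dotBl /w pickleK; set d := _ - _.
rewrite dotZr -dotE expr2 mulrA.
have [->|d0] := eqVneq `|d| 0; first by rewrite mulr0.
by rewrite mulVf// mul1r.
Qed.

Let fL n : lipschitz_real k (fun t => dot (gam t) (w n)).
Proof.
move=> s t; rewrite -dotBl (le_trans (cauchy_schwarz dotE _ _))//.
by rewrite (le_trans _ (gamL s t))// ler_piMr.
Qed.

(** [G] is the supremum of the derivatives of the functions [dot (gam _) (w n)].
    The increment of [gam] between rational points is the increment of one of
    these functions, hence bounded by the integral of [G]; the general case
    follows by density. *)
Let norming_density : exists G : R -> R,
  [/\ forall t, `|G t| <= k,
    forall s t, a <= s -> s <= t -> t <= b ->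
      `|gam t - gam s| <= \int[mu]_(u in `]a, t]) G u -
                         \int[mu]_(u in `]a, s]) G u,
    measurable_fun setT G &
    {ae mu, forall s, a < s < b -> forall e, 0 < e -> exists n,
      derivable (fun t => dot (gam t) (w n)) s 1 /\
      G s - e < derive1 (fun t => dot (gam t) (w n)) s}].
Proof.
have /choice[phi /all_and4[mphi phi_le dphi phiE]] n :=
  lipschitz_FTC k0 (fL n) ab.
pose G t := sups (phi ^~ t) 0.
have Gub t : has_ubound (range (phi ^~ t)).
  exists k => _ [n _ <-]; exact: le_trans (ler_norm _) (phi_le n t).
have GE t : G t = sup (range (phi ^~ t)).
  by rewrite /G /sups/=; congr sup; apply/seteqP; split=> _ [n _ <-]; exists n.
have phiG n t : phi n t <= G t.
  by rewrite GE; apply: ub_le_sup => //; exists n.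
have Gk t : `|G t| <= k.
  rewrite ler_norml; apply/andP; split.
    apply: le_trans (phiG 0 t); have := phi_le 0 t.
    by rewrite ler_norml => /andP[].
  rewrite GE; apply: ge_sup; first by exists (phi 0 t), 0%N.
  by move=> _ [n _ <-]; exact: le_trans (ler_norm _) (phi_le n t).
have mG : measurable_fun setT G by exact: measurable_fun_sups.
have bint (f : R -> R) c d : measurable_fun setT f -> (forall t, `|f t| <= k) ->
    mu.-integrable `]c, d]%classic (EFin \o f).
  exact: bounded_itvoc_integrable.
have intB (f : R -> R) s t : measurable_fun setT f -> (forall t, `|f t| <= k) ->
    a <= s -> s <= t ->
    \int[mu]_(u in `]a, t]) f u - \int[mu]_(u in `]a, s]) f u =
    \int[mu]_(u in `]s, t]) f u.
  by move=> mf fk as_ st; rewrite Rintegral_itvB//; exact: bint.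
have ratG (p q : rat) : a <= ratr p -> ratr p <= ratr q :> R -> ratr q <= b ->
    `|gam (ratr q) - gam (ratr p)| <= \int[mu]_(u in `]a, ratr q]) G u -
                                     \int[mu]_(u in `]a, ratr p]) G u.
  move=> ap pq qb; rewrite -w_norming; set n := pickle _.
  rewrite intB//.
  have -> : dot (gam (ratr q)) (w n) - dot (gam (ratr p)) (w n) =
      \int[mu]_(u in `]ratr p, ratr q]) phi n u.
    rewrite -intB// -!phiE ?ap ?qb ?(le_trans ap) ?(le_trans pq)//.
    by rewrite opprB addrA subrK.
  by apply: le_Rintegral => //; exact: bint.
have GL s t : a <= s -> s <= t ->
    `|\int[mu]_(u in `]a, t]) G u - \int[mu]_(u in `]a, s]) G u| <= k * (t - s).
  move=> as_ st; rewrite intB//.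
  apply: le_trans (le_normr_Rintegral _ _) _ => //; first exact: bint.
  rewrite -(Rintegral_itvoc_cst _ st).
  apply: le_Rintegral => //.
  - apply: bint => [|u]; first exact: measurableT_comp.
    by rewrite normr_id.
  - by apply: bint => // u; rewrite gtr0_norm.
exists G; split=> // [s t as_ st tb|].
- move: st; rewrite le_eqVlt => /predU1P[->|st].
    by rewrite !subrr normr0.
  apply/ler_addgt0Pr => e e0.
  (* moving both end points by [d / 2] costs [k d] in [gam] and [k d] in the
     integral of [G] *)
  pose d := Num.min (t - s) (e / (4 * k)).
  have d0 : 0 < d by rewrite lt_min subr_gt0 st divr_gt0// mulr_gt0.
  have dts : d <= t - s by rewrite /d ge_min lexx.
  have dk : 4 * k * d <= e.
    by rewrite mulrC -ler_pdivlMr ?mulr_gt0// /d ge_min lexx orbT.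
  have [|p] := @rat_in_itvoo _ s (s + d / 2); first by rewrite ltrDl divr_gt0.
  rewrite in_itv/= => /andP[sp pd].
  have [|q] := @rat_in_itvoo _ (t - d / 2) t.
    by rewrite ltrBlDr ltrDl divr_gt0.
  rewrite in_itv/= => /andP[dq qt].
  have pq : ratr p <= ratr q :> R by lra.
  have := ratG p q; rewrite (le_trans as_ (ltW sp)) pq.
  rewrite (le_trans (ltW qt) tb) => /(_ isT isT isT) pqG.
  have G1 := GL _ _ as_ (ltW sp).
  have G2 := GL _ _ (le_trans (le_trans as_ (ltW sp)) pq) (ltW qt).
  have g1 := gamL (ratr p) s; have g2 := gamL t (ratr q).
  have -> : gam t - gam s = (gam t - gam (ratr q)) +
      (gam (ratr q) - gam (ratr p)) + (gam (ratr p) - gam s).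
    by rewrite !addrA !subrK.
  apply: le_trans (ler_normD _ _) _.
  apply: le_trans (lerD (ler_normD _ _) (lexx _)) _.
  move: G1 G2 g1 g2; rewrite !ler_norml => /andP[G1 G1'] /andP[G2 G2'].
  rewrite !gtr0_norm ?subr_gt0// => g1 g2.
  have kp : k * (ratr p - s) <= k * (d / 2).
    by rewrite ler_pM2l// lerBlDl ltW.
  have kq : k * (t - ratr q) <= k * (d / 2).
    by rewrite ler_pM2l// lerBlDr -lerBlDl ltW.
  by clear ratG GL bint intB mphi dphi phiE phi_le dts d0; lra.
- have : {ae mu, forall s, forall n, a < s <= b ->
      derivable (fun t => dot (gam t) (w n)) s 1 /\
      derive1 (fun t => dot (gam t) (w n)) s = phi n s}.
    apply: ae_foralln => n; exact: dphi.
  apply: filterS => s ds /andP[as_ sb] e e0.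
  have [|_ [n _ <-]] := sup_adherent e0 (_ : has_sup (range (phi ^~ s))).
    by split=> //; exists (phi 0 s), 0%N.
  rewrite -GE => Gn; exists n.
  by have [|df ->] := ds n; first by rewrite as_ ltW.
Qed.

Lemma lipschitz_ae_derivable : {ae mu, forall s, a < s < b -> derivable gam s 1}.
Proof.
have [G [Gk gamG mG dG]] := norming_density.
have bint K : measurable K -> (mu K < +oo)%E -> mu.-integrable K (EFin \o G).
  move=> mK Koo; apply: measurable_bounded_integrable => //.
    exact: measurable_funTS.
  exists k; split; first by rewrite num_real.
  by move=> M kM t _ /=; rewrite (le_trans (Gk t))// ltW.
have locG : locally_integrable setT G.
  split=> //; first exact: openT.
  move=> K _ cK; have mK := compact_measurable cK.
  have /integrableP[_] := bint K mK (compact_finite_measure cK).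
  by under eq_integral do rewrite /= .
have intG : mu.-integrable `]a, b]%classic (EFin \o G).
  apply: bint => //; rewrite lebesgue_measure_itv/=.
  by case: ifP => // _; rewrite -EFinB ltry.
have := lebesgue_differentiation locG.
apply: filterS2 dG => s dfs Gpt /andP[as_ sb].
pose GG x := \int[mu]_(u in `]a, x]) G u.
have [dGG GGE] : derivable GG s 1 /\ derive1 GG s = G s.
  by apply: (FTC1_lebesgue_pt sb intG) => //; rewrite lte_fin.
have {dGG GGE} GGcvg : h^-1 *: (GG (h + s) - GG s) @[h --> 0^'] --> G s.
  rewrite -GGE derive1E; apply: cvg_trans dGG.
  by apply: near_eq_cvg; near=> h; rewrite /= scaler1.
have nears : \forall h \near 0^', a <= h + s <= b.
  have d0 : 0 < Num.min (s - a) (b - s) by rewrite lt_min !subr_gt0 as_.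
  apply: filterS (dnbhs0_le d0) => h.
  by rewrite ler_norml le_min => /andP[+ /andP[]]; rewrite lerNl le_min; lra.
have neq0 : \forall h \near (0 : R)^', h != 0 by exact: nbhs_dnbhs_neq.
apply: (@cvg_of_norming _ _ _ _ (G s)) => e e0.
- have := cvgr_le _ GGcvg; move=> /(_ _ (G s + e)); rewrite ltrDl => /(_ e0).
  apply: filterS3 nears neq0 => h /andP[ah hb] h0; apply: le_trans.
  rewrite /= scaler1 normrZ normfV.
  have [hp|hn] := ltP 0 h.
    rewrite gtr0_norm// ler_pM2l ?invr_gt0//.
    by apply: gamG => //; [exact: ltW|rewrite lerDr ltW].
  have {}hn : h < 0 by rewrite lt_neqAle h0.
  rewrite ltr0_norm// distrC -[leRHS]opprK -[- (h^-1 *: _)]scalerN opprB.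
  rewrite -scaleNr -invrN ler_pM2l ?invr_gt0 ?oppr_gt0//.
  by apply: gamG => //; [rewrite gerDr ltW|exact: ltW].
- have [|n [df Gn]] := dfs _ e e0; first by rewrite as_.
  exists (w n); split=> //.
  move: Gn; rewrite derive1E => Gn; have := cvgr_ge _ df; move=> /(_ _ _ Gn).
  apply: filterS => h /le_trans; apply.
  by rewrite /= dotZl dotBl.
Unshelve. all: by end_near. Qed.

End AeDerivable.
End HilbertLipschitz.

(** * Integrals of functions that are measurable up to a null set *)

Import HBNNSimple.

Section LowerIntegral.
Local Open Scope ereal_scope.
Context d (T : measurableType d) (R : realType).
Variable mu : {measure set T -> \bar R}.

(** The integral of an arbitrary nonnegative function is the supremum of the
    integrals of the simple functions below it, a lower integral; it ignores null
    sets as soon as one of the two functions is measurable. *)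
Lemma ge0_integral_ae_measurable (f g : T -> \bar R) :
  (forall x, 0 <= f x) -> (forall x, 0 <= g x) ->
  measurable_fun setT g -> {ae mu, forall x, f x = g x} ->
  \int[mu]_x f x = \int[mu]_x g x.
Proof.
move=> f0 g0 mg [N [mN N0 fgN]].
have fg x : ~ N x -> f x = g x by move=> Nx; apply: contrapT => /fgN.
have gN : \int[mu]_x g x = \int[mu]_(x in ~` N) g x.
  by rewrite (ge0_negligible_integral mN)// setTD.
apply/eqP; rewrite eq_le; apply/andP; split.
- rewrite [leLHS]ge0_integralTE//; apply: ge_ereal_sup => _ [h hf <-].
  have mh : measurable_fun setT (fun x => (h x)%:E).
    by apply/measurable_EFinP.
  rewrite -integralT_nnsfun gN (ge0_negligible_integral mN)//; last first.
    by move=> x _; rewrite lee_fin.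
  rewrite setTD; apply: ge0_le_integral => //.
  + exact: measurableC.
  + by move=> x _; rewrite lee_fin.
  + exact: measurable_funTS.
  + exact: measurable_funTS.
  + by move=> x /fg <-; exact: hf.
- rewrite gN integral_mkcond ge0_integralTE; last exact: erestrict_ge0.
  rewrite [leRHS]ge0_integralTE//; apply: le_ereal_sup => _ [h hg <-].
  exists h => // x; apply: le_trans (hg x) _.
  by rewrite patchE; case: ifPn => // /set_mem /fg <-.
Qed.

(** Meant for integrands built from a pointwise derivative, which takes
    default values on the null set where the derivative does not exist. *)
Lemma integral_ae_measurable (D : set T) (f g : T -> \bar R) : measurable D ->
  measurable_fun D g -> {ae mu, forall x, D x -> f x = g x} ->
  \int[mu]_(x in D) f x = \int[mu]_(x in D) g x.
Proof.
move=> mD mg fg; rewrite integral_mkcond [RHS]integral_mkcond.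
have {mg}mg : measurable_fun setT (g \_ D) by exact/(measurable_restrictT _ mD).1.
have {fg}fg : {ae mu, forall x, (f \_ D) x = (g \_ D) x}.
  apply: filterS fg => x fg; rewrite !patchE.
  by case: ifPn => // /set_mem /fg.
rewrite integralE [RHS]integralE; congr (_ - _).
- apply: ge0_integral_ae_measurable => //; first exact: measurable_funepos.
  by apply: filterS fg => x fgx; rewrite !funeposE fgx.
- apply: ge0_integral_ae_measurable => //; first exact: measurable_funeneg.
  by apply: filterS fg => x fgx; rewrite !funenegE fgx.
Qed.

End LowerIntegral.

(** * Functions that are Lipschitz on bounded intervals of the half line *)

Section Clamp.
Variables (R : realType).
Notation mu := (@lebesgue_measure R).

Definition lipschitz_itv (V : normedModType R) (b k : R) (f : R -> V) :=
  forall s t, 0 <= s <= b -> 0 <= t <= b -> `|f s - f t| <= k * `|s - t|.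

Definition clamp (b t : R) : R := Num.max 0 (Num.min t b).

Lemma clamp_itv b t : 0 <= b -> 0 <= clamp b t <= b.
Proof. by move=> b0; rewrite /clamp le_max lexx ge_max b0 ge_min lexx orbT. Qed.

Lemma clamp_id b t : 0 <= t <= b -> clamp b t = t.
Proof. by move=> /andP[t0 tb]; rewrite /clamp min_l// max_r. Qed.

Lemma max_lip (a s t : R) : `|Num.max a s - Num.max a t| <= `|s - t|.
Proof.
wlog st : s t / s <= t.
  by case: (leP s t) => [|/ltW] st H; [|rewrite distrC [leRHS]distrC]; exact: H.
rewrite distrC [leRHS]distrC ger0_norm ?subr_ge0 ?ge_max ?le_max ?lexx ?st ?orbT//.
rewrite ger0_norm ?subr_ge0//.
by case: (leP a s); case: (leP a t); lra.
Qed.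

Lemma clamp_lip b s t : `|clamp b s - clamp b t| <= `|s - t|.
Proof.
apply: le_trans (max_lip _ _ _) _.
rewrite -[leLHS]normrN opprD !oppr_min -[leRHS]normrN opprD.
by rewrite ![Num.max (- _) (- b)]maxC max_lip.
Qed.

Lemma lipschitz_clamp (V : normedModType R) b k (f : R -> V) : 0 <= b ->
  0 < k -> lipschitz_itv b k f -> lipschitz_real k (f \o clamp b).
Proof.
move=> b0 k0 fL s t /=; apply: le_trans (fL _ _ _ _) _; rewrite ?clamp_itv//.
by rewrite ler_pM2l// clamp_lip.
Qed.

Lemma near_clamp (b s : R) : 0 < s < b -> \forall t \near s, clamp b t = t.
Proof.
move=> /andP[s0 sb]; near=> t; apply: clamp_id; apply/andP; split.
  by apply/ltW; near: t; exact: lt_nbhsr.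
by apply/ltW; near: t; exact: lt_nbhsl.
Unshelve. all: by end_near. Qed.

Lemma halfline_ae (P : R -> Prop) :
  (forall b : R, 0 < b -> {ae mu, forall s, 0 < s < b -> P s}) ->
  {ae mu, forall s, 0 < s -> P s}.
Proof.
move=> Pb.
have : {ae mu, forall s, forall n : nat, 0 < s < n.+1%:R -> P s}.
  by apply: ae_foralln => n; exact: Pb.
apply: filterS => s Ps s0; apply: (Ps (Num.bound s)).
by rewrite s0 (lt_le_trans (archi_boundP (ltW s0)))// ler_nat.
Qed.

Lemma halfline_ae_derivable (H : completeNormedModType R)
    (dot : {dot H for @idfun R}) (f : R -> H) : induces_norm dot ->
  (forall b, 0 < b -> exists2 k, 0 < k & lipschitz_itv b k f) ->
  {ae mu, forall s, 0 < s -> derivable f s 1}.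
Proof.
move=> dotE fL; apply: halfline_ae => b b0; have [k k0 fb] := fL b b0.
have := lipschitz_ae_derivable dotE k0 (lipschitz_clamp (ltW b0) k0 fb) b0.
apply: filterS => s ds sb; have := ds sb.
by apply: near_eq_derivable; apply: filterS (near_clamp sb) => t /= ->.
Qed.

Lemma halfline_ae_derivable_real (f : R -> R) :
  (forall b, 0 < b -> exists2 k, 0 < k & lipschitz_itv b k f) ->
  {ae mu, forall s, 0 < s -> derivable f s 1}.
Proof.
move=> fL; apply: halfline_ae => b b0; have [k k0 fb] := fL b b0.
have [phi [_ _ dphi _]] :=
  lipschitz_FTC k0 (lipschitz_clamp (ltW b0) k0 fb) b0.
apply: filterS dphi => s ds sb; have [|df _] := ds.
  by case/andP: sb => -> /ltW.
by move: df; apply: near_eq_derivable; apply: filterS (near_clamp sb) => t /= ->.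
Qed.

Lemma lipschitz_itv_ac (V : normedModType R) (f : R -> V) :
  (forall b, 0 < b -> exists2 k, 0 < k & lipschitz_itv b k f) ->
  locally_absolutely_continuous f.
Proof.
move=> fL b b0 e e0; have [|k k0 fb] := fL (b + 1); first by rewrite ltr_wpDl.
exists (e / k); first by rewrite divr_gt0.
move=> n p q pq _ sumd.
apply: (@le_lt_trans _ _ (k * \sum_(i < n) (q i - p i))); last first.
  by rewrite mulrC -ltr_pdivlMr.
rewrite mulr_sumr; apply: ler_sum => i _; have [ap pqi qb] := pq i.
apply: le_trans (fb _ _ _ _) _.
- by rewrite (le_trans ap)//= (le_trans qb)// lerDl.
- by rewrite ap/= (le_trans (le_trans pqi qb))// lerDl.
- by rewrite ger0_norm// subr_ge0.
Qed.

(** An upper bound on the right Dini derivatives bounds the almost everywhere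
    derivative, which integrates back to the function. *)
Lemma lipschitz_dini_le (f : R -> R) (k a b : R) : 0 < k ->
  lipschitz_real k f -> a < b ->
  (forall u, a < u <= b -> forall e, 0 < e ->
    \forall h \near 0^'+, f (h + u) - f u <= e * h) ->
  f b <= f a.
Proof.
move=> k0 fL ab dini.
have [phi [mphi phik dphi phiE]] := lipschitz_FTC k0 fL ab.
rewrite -subr_le0 phiE; last by rewrite (ltW ab) lexx.
have mphi0 : measurable_fun setT (fun u => Num.min 0 (phi u)).
  by apply: measurable_minr.
have -> : \int[mu]_(t in `]a, b]) phi t =
    \int[mu]_(t in `]a, b]) Num.min 0 (phi t).
  apply: Rintegral_ae_eq => //; try exact: measurable_funTS.
  apply: filterS dphi => u du; rewrite /= in_itv/= => uab.
  have [df <-] := du uab; rewrite min_r//.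
  apply/ler_addgt0Pr => e e0; rewrite add0r.
  have : h^-1 *: (f (h + u) - f u) @[h --> 0^'] --> derive1 f u.
    rewrite derive1E; apply: cvg_trans df.
    by apply: near_eq_cvg; near=> h; rewrite /= scaler1.
  move=> /cvg_dnbhs_at_right dfu; apply: (cvgr_to_le dfu).
  have := dini u uab e e0; apply: filterS2 (nbhs_right_gt 0) => h h0.
  by rewrite ler_pdivrMl// mulrC.
rewrite -[leRHS](mul0r (b - a)) -Rintegral_itvoc_cst ?(ltW ab)//.
apply: le_Rintegral => //.
- apply: (@bounded_itvoc_integrable _ _ k) => // u.
  rewrite (le_trans _ (phik u))//.
  by case: (leP 0 (phi u)) => // _; rewrite normr0.
- by apply: (@bounded_itvoc_integrable _ _ 0) => // u; rewrite normr0.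
- by move=> u _; rewrite ge_min lexx.
Unshelve. all: by end_near. Qed.

End Clamp.

(** * One-sided derivatives and scalar products *)

Section Derivatives.
Variables (R : realType).

(** First-order expansion equivalent to the one-sided derivative; unlike the
    difference quotient it also makes sense at [s = t]. *)
Lemma halfline_expansion (V : normedModType R) (f : R -> V) t l e :
  is_derive_halfline f t l -> 0 < e ->
  \forall s \near t, 0 <= s -> `|f s - f t - (s - t) *: l| <= e * `|s - t|.
Proof.
move=> /cvgrPdist_le df e0; have := df _ e0.
rewrite !near_withinE; apply: filterS => s Hs s0.
have [->|st] := eqVneq s t; first by rewrite !subrr scale0r subr0 !normr0 mulr0.
have := Hs st; rewrite /= in_itv/= s0 => /(_ isT) ds.
have st0 : s - t != 0 by rewrite subr_eq0.
have -> : f s - f t - (s - t) *: l = - ((s - t) *: (l - (s - t)^-1 *: (f s - f t))).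
  by rewrite scalerBr scalerA divff// scale1r opprB.
by rewrite normrN normrZ mulrC ler_wpM2r.
Qed.

Lemma halfline_is_derive (V : normedModType R) (f : R -> V) t l :
  0 < t -> is_derive_halfline f t l -> is_derive t 1 f l.
Proof.
move=> t0 df.
have cv : h^-1 *: ((f \o shift t) (h *: 1) - f t) @[h --> 0^'] --> l.
  apply/cvgrPdist_le => e e0.
  have near_t : \forall s \near t, 0 < s /\
      `|f s - f t - (s - t) *: l| <= e * `|s - t|.
    apply: filterS2 (lt_nbhsr t0) (halfline_expansion df e0) => s s0 fs.
    by split => //; exact/fs/ltW.
  have {}near_t := nbhs_dnbhs ((nbhs0P _ _).1 near_t).
  apply: filterS2 (nbhs_dnbhs_neq 0) near_t => h h0 [th].
  have -> : t + h - t = h by rewrite addrAC subrr add0r.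
  move=> ft.
  rewrite /= scaler1.
  have -> : l - h^-1 *: (f (h + t) - f t) = - (h^-1 *: (f (t + h) - f t - h *: l)).
    by rewrite [in RHS]scalerBr scalerA mulVf// scale1r opprB (addrC t).
  by rewrite normrN normrZ normfV ler_pdivrMl ?normr_gt0// mulrC.
apply: DeriveDef; first by apply/cvg_ex; exists l.
exact: cvg_lim cv.
Qed.

Variables (H : completeNormedModType R) (dot : {dot H for @idfun R}).
Hypothesis dotE : induces_norm dot.

Lemma cvg_dotl (T : Type) (F : set_system T) (FF : Filter F) (D : T -> H) l w :
  D @ F --> l -> (dot (D t) w @[t --> F]) --> dot l w.
Proof.
move=> /cvgrPdist_le Dl; apply/cvgrPdist_le => e e0.
have w0 : 0 < `|w| + 1 by rewrite ltr_wpDl.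
have := Dl (e / (`|w| + 1)); rewrite divr_gt0// => /(_ isT).
apply: filterS => t; rewrite ler_pdivlMr// => tl.
rewrite -dotBl (le_trans (cauchy_schwarz dotE _ _))// (le_trans _ tl)//.
by rewrite ler_wpM2l// lerDl.
Qed.

Lemma is_derive_dotl (f : R -> H) (t : R) (l w : H) :
  is_derive t 1 f l -> is_derive t 1 (fun s => dot (f s) w) (dot l w).
Proof.
move=> [df <-].
have cv : h^-1 *: (((fun s => dot (f s) w) \o shift t) (h *: 1) - dot (f t) w)
    @[h --> 0^'] --> dot ('D_1 f t) w.
  pose D h := h^-1 *: ((f \o shift t) (h *: 1) - f t).
  have dfD : D h @[h --> 0^'] --> 'D_1 f t by exact: df.
  apply: cvg_trans (cvg_dotl _ (w := w) dfD).
  by apply: near_eq_cvg; near=> h; rewrite /= dotZl dotBl.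
apply: DeriveDef; first by apply/cvg_ex; exists (dot ('D_1 f t) w).
exact: cvg_lim cv.
Unshelve. all: by end_near. Qed.

End Derivatives.

(** * Lipschitz bounds along the trajectory *)

Section Trajectory.
Variables (R : realType) (H : completeNormedModType R).
Variable dot : {dot H for @idfun R}.
Hypothesis dotE : induces_norm dot.
Variables (theta : R) (x y v : R -> H) (p : R -> R).
Hypotheses (theta0 : 0 < theta) (p0 : forall t : R, 0 <= t -> 0 < p t).
Hypothesis xE : forall t : R, 0 <= t -> x t = y t + (p t)^-1 *: v t.
Hypothesis vE : forall t : R, 0 <= t -> `|v t| = theta * p t ^+ 2.
Hypothesis mono : forall s t : R, 0 <= s -> 0 <= t ->
  0 <= dot (y s - y t) (v s - v t).
Hypothesis dx : forall t : R, 0 <= t -> is_derive_halfline x t (- ((p t)^-1 *: v t)).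

Let dist_p s t : 0 <= s -> 0 <= t -> theta * `|p s - p t| <= `|x s - x t|.
Proof.
move=> s0 t0; exact: (monotone_pair_dist_p dotE theta0 (p0 s0) (p0 t0) (xE s0) (xE t0)
  (vE s0) (vE t0) (mono s0 t0)).
Qed.

Let max0_ge0 (t : R) : 0 <= Num.max 0 t.
Proof. by rewrite le_max lexx. Qed.

Let x_continuous : continuous (fun t : R => x (Num.max 0 t)).
Proof.
move=> t; set u := Num.max 0 t; set l := - ((p u)^-1 *: v u).
have k0 : 0 < 1 + `|l| by rewrite ltr_pwDl.
have := halfline_expansion (dx (max0_ge0 t)) ltr01; rewrite -/u -/l => xu.
apply/cvgrPdist_le => e e0.
have [d d0 xd] : exists2 d, 0 < d & forall s, `|u - s| < d -> 0 <= s ->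
    `|x s - x u| <= (1 + `|l|) * `|s - u|.
  move: xu => [d d0 xu]; exists d => // s us s0.
  have := xu s us s0 => le1.
  have -> : x s - x u = (x s - x u - (s - u) *: l) + (s - u) *: l by rewrite subrK.
  rewrite (le_trans (ler_normD _ _))// mulrDl lerD//.
  by rewrite normrZ mulrC.
exists (Num.min d (e / (1 + `|l|))); first by rewrite /= lt_min d0 divr_gt0.
move=> s /=; rewrite lt_min => /andP[sd se].
have us : `|u - Num.max 0 s| <= `|t - s| by exact: max_lip.
rewrite distrC (le_trans (xd _ _ _))//; first exact: le_lt_trans sd.
by rewrite mulrC -ler_pdivlMr// distrC (le_trans us)// ltW.
Qed.

Let p_continuous : continuous (fun t : R => p (Num.max 0 t)).
Proof.
move=> t; apply/cvgrPdist_le => e e0.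
have /cvgrPdist_le := @x_continuous t.
move=> /(_ (theta * e)); rewrite mulr_gt0// => /(_ isT).
apply: filterS => s xs; rewrite -(ler_pM2l theta0).
by apply: le_trans xs; exact: dist_p.
Qed.

(** [p] is continuous because [x] is and [p] is a Lipschitz function of [x]. *)
Lemma p_bounds b : 0 < b ->
  exists m M, [/\ 0 < m, 0 < M & forall t, 0 <= t <= b -> m <= p t <= M].
Proof.
move=> b0; have pc : {within `[0, b], continuous (fun t : R => p (Num.max 0 t))}.
  exact: continuous_subspaceT.
have [c + cM] := EVT_max (ltW b0) pc; rewrite in_itv/= => /andP[c0 _].
have [d + dm] := EVT_min (ltW b0) pc; rewrite in_itv/= => /andP[d0 _].
exists (p d), (p c); split; [exact: p0|exact: p0|].
move=> t tb; have /andP[t0 _] := tb.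
have := cM t; have := dm t; rewrite in_itv/= tb => /(_ isT) + /(_ isT).
by rewrite !max_r// => -> ->.
Qed.

Section Bounded.
Variables (b m M : R).
Hypotheses (m0 : 0 < m) (M0 : 0 < M).
Hypothesis pmM : forall t : R, 0 <= t <= b -> m <= p t <= M.

(** The speed of [x] is [`|v / p| = theta * p <= theta * M]; the mean value
    theorem is applied to the component of [x] along [x t - x s]. *)
Lemma x_lipschitz : lipschitz_itv b (theta * M) x.
Proof.
move=> s t; wlog st : s t / s <= t.
  move=> wl s0 t0; have [/wl|/ltW/wl] := leP s t; first exact.
  by rewrite distrC [`|t - s|]distrC; exact.
move=> /andP[s0 sb] /andP[t0 tb].
move: st; rewrite le_eqVlt => /predU1P[->|st]; first by rewrite !subrr !normr0 mulr0.
set w := x t - x s.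
have [w0|w0] := eqVneq w 0.
  by rewrite distrC -/w w0 normr0 !mulr_ge0// ltW.
have xmax (u : R) : 0 < u -> \forall z \near u, x z = x (Num.max 0 z).
  by move=> u0; apply: filterS (lt_nbhsr u0) => z z0; rewrite max_r// ltW.
pose phi (u : R) := dot (x (Num.max 0 u)) w.
have dphi u : u \in `]s, t[ -> is_derive u 1 phi (dot (- ((p u)^-1 *: v u)) w).
  rewrite in_itv/= => /andP[su _]; have u0 := le_lt_trans s0 su.
  apply: is_derive_dotl => //; apply: (near_eq_is_derive (xmax u u0)).
  exact: halfline_is_derive u0 (dx (ltW u0)).
have phic : {within `[s, t], continuous phi}.
  apply: continuous_subspaceT => u.
  by apply: (cvg_dotl dotE); exact: x_continuous.
have [c] := MVT st dphi phic; rewrite /phi.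
rewrite in_itv/= => /andP[sc ct].
rewrite !max_r// -dotBl -/w -dotE => wE.
have c0 := le_trans s0 (ltW sc).
have /andP[mc cM] : m <= p c <= M by rewrite pmM// c0 (le_trans (ltW ct)).
rewrite distrC [`|s - t|]distrC -/w (gtr0_norm (_ : 0 < t - s)) ?subr_gt0//.
have w1 : 0 < `|w| by rewrite normr_gt0.
rewrite -(ler_pM2r w1) -expr2 wE mulrAC ler_pM2r ?subr_gt0//.
rewrite (le_trans (dot_le dotE _ _))// ler_wpM2r//.
rewrite normrN normrZ vE// gtr0_norm ?invr_gt0 ?p0//.
rewrite mulrCA expr2 mulKf ?gt_eqF ?p0//.
by rewrite ler_pM2l.
Qed.

Lemma p_lipschitz : lipschitz_itv b M p.
Proof.
move=> s t sb tb; rewrite -(ler_pM2l theta0) mulrA.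
have [/andP[s0 _] /andP[t0 _]] := (sb, tb).
by apply: le_trans (dist_p s0 t0) _; exact: x_lipschitz.
Qed.

Lemma v_lipschitz : lipschitz_itv b (2 * M * (theta * M)) v.
Proof.
move=> s t sb tb; have [/andP[s0 _] /andP[t0 _]] := (sb, tb).
apply: le_trans (monotone_pair_dist_v dotE (p0 s0) (p0 t0) (xE s0) (xE t0)
  (vE s0) (vE t0) (mono s0 t0)) _.
have [/andP[_ psM] /andP[_ ptM]] := (pmM sb, pmM tb).
rewrite -[leRHS]mulrA; apply: ler_pM => //.
- by rewrite addr_ge0// ltW// p0.
- by lra.
- exact: x_lipschitz.
Qed.

Lemma y_lipschitz : exists2 k, 0 < k & lipschitz_itv b k y.
Proof.
exists (theta * M + (m^-1 * (2 * M * (theta * M)) +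
  (M / (m * m)) * (theta * M ^+ 2))).
  have mM0 : 0 < 2 * M * (theta * M) by rewrite !mulr_gt0.
  by do ?[apply: addr_gt0|apply: mulr_gt0]; rewrite ?invr_gt0 ?mulr_gt0 ?exprn_gt0.
move=> s t sb tb; have [/andP[s0 _] /andP[t0 _]] := (sb, tb).
have [/andP[ms psM] /andP[mt ptM]] := (pmM sb, pmM tb).
have yE u : 0 <= u -> y u = x u - (p u)^-1 *: v u.
  by move=> u0; rewrite xE// addrK.
have -> : y s - y t = (x s - x t) - ((p s)^-1 *: (v s - v t) +
    ((p s)^-1 - (p t)^-1) *: v t).
  rewrite !yE// scalerBr scalerBl addrA subrK opprB.
  by rewrite opprD opprK addrACA [- _ + _]addrC [- _ - x t]addrC addrACA.
rewrite (le_trans (ler_normB _ _))// mulrDl lerD ?x_lipschitz//.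
rewrite (le_trans (ler_normD _ _))// mulrDl lerD// normrZ.
- rewrite -[leRHS]mulrA; apply: ler_pM => //; last exact: v_lipschitz.
  by rewrite gtr0_norm ?invr_gt0 ?p0// lef_pV2// posrE p0.
- rewrite vE// mulrAC; apply: ler_pM => //; first by rewrite mulr_ge0 ?sqr_ge0// ltW.
    have -> : (p s)^-1 - (p t)^-1 = - ((p s - p t) / (p s * p t)).
      by field; rewrite !gt_eqF ?p0.
    rewrite normrN normrM normfV mulrAC; apply: ler_pM => //.
      exact: p_lipschitz.
    rewrite gtr0_norm ?mulr_gt0 ?p0// lef_pV2 ?posrE ?mulr_gt0 ?p0//.
    by apply: ler_pM => //; exact: ltW.
  by rewrite ler_pM2l// ler_pXn2r// ?nnegrE ltW// p0.
Qed.

(** Concavity of the logarithm: [ln (p t) - ln (p s) <= (p t - p s) / p s]. *)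
Lemma lnp_lipschitz : lipschitz_itv b (M / m) (fun t => ln (p t)).
Proof.
move=> s t; wlog pst : s t / p s <= p t.
  move=> wl s0 t0; have [/wl|/ltW/wl] := leP (p s) (p t); first exact.
  by rewrite distrC [`|t - s|]distrC; exact.
move=> sb tb; have [/andP[s0 _] /andP[t0 _]] := (sb, tb).
have [ps pt] := (p0 s0, p0 t0).
have [/andP[ms psM] /andP[mt ptM]] := (pmM sb, pmM tb).
rewrite distrC [`|s - t|]distrC ger0_norm ?subr_ge0 ?ler_ln ?posrE//.
rewrite -ln_div ?posrE//.
have -> : p t / p s = 1 + (p t - p s) / p s by field; rewrite gt_eqF.
apply: (@le_trans _ _ ((p t - p s) / p s)).
  by apply: le_ln1Dx; rewrite (@lt_le_trans _ _ 0)// divr_ge0 ?subr_ge0// ltW.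
rewrite mulrAC; apply: ler_pM => //.
- by rewrite subr_ge0.
- by rewrite invr_ge0 ltW.
- by rewrite (le_trans (ler_norm _))// p_lipschitz.
- by rewrite lef_pV2.
Qed.

End Bounded.

(** Between [u] and [u + h] the trajectory is an Euler step up to an error
    [o(h)], so all the right Dini derivatives of [p] are nonpositive. *)
Lemma p_nonincreasing s t : 0 <= s -> s <= t -> p t <= p s.
Proof.
move=> s0; rewrite le_eqVlt => /predU1P[->//|st].
have t0 : 0 < t := le_lt_trans s0 st.
have t10 : 0 < t + 1 by rewrite addr_gt0.
have [m [M [m0 M0 pmM]]] := p_bounds t10.
have pL := lipschitz_clamp (ltW t10) M0 (p_lipschitz M0 pmM).
have pcl u : s <= u <= t -> clamp (t + 1) u = u.
  by move=> /andP[su ut]; rewrite clamp_id// (le_trans s0 su)/= (le_trans ut)// lerDl.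
have := lipschitz_dini_le M0 pL st; rewrite /= !pcl ?lexx ?(ltW st)//; apply.
move=> u /andP[su ut] e e0.
have u0 : 0 < u := le_lt_trans s0 su.
rewrite pcl ?(ltW su)//.
have e20 : 0 < theta * e / 2 by rewrite !mulr_gt0.
have xu := @cvg_within _ (nbhs (0 : R)) _ (fun h => 0 < h) _
  ((nbhs0P _ _).1 (halfline_expansion (dx (ltW u0)) e20)).
near=> h.
have h0 : 0 < h by near: h; exact: nbhs_right_gt.
have h1 : h < 1 by near: h; exact: nbhs_right_lt.
have xuh : 0 <= u + h ->
    `|x (u + h) - x u - (u + h - u) *: - ((p u)^-1 *: v u)| <=
    theta * e / 2 * `|u + h - u|.
  by near: h; exact: xu.
have uh0 : 0 <= u + h by rewrite addr_ge0// ltW.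
have uhu : u + h - u = h by rewrite addrAC subrr add0r.
move: xuh; rewrite uhu => /(_ uh0).
rewrite (addrC h u) clamp_id; last first.
  by rewrite uh0 lerD// ltW.
set r := x (u + h) - x u - h *: - ((p u)^-1 *: v u) => rle.
have x12 : x u - x (u + h) = (h / p u) *: v u + - r.
  by rewrite /r scalerN scalerA opprK opprD opprB addrCA subrr addr0.
have := monotone_pair_decrease dotE theta0 (p0 (ltW u0)) (p0 uh0) (xE (ltW u0))
  (xE uh0) (vE (ltW u0)) (vE uh0) (mono (ltW u0) uh0) _ x12.
rewrite (ltW h0) (ltW h1) => /(_ isT); rewrite normrN => le1.
rewrite -(ler_pM2l theta0) (le_trans le1)//.
by move: rle; rewrite gtr0_norm//; lra.
Unshelve. all: by end_near. Qed.

End Trajectory.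

(** * The time change and the equation in the new time *)

Section TimeRescaling.
Variable R : realType.
Notation mu := (@lebesgue_measure R).

Lemma ae_neq (a : R) : {ae mu, forall s, s != a}.
Proof.
exists [set a]; split; first exact: measurable_set1.
  exact: lebesgue_measure_set1.
by move=> s /= /negP; rewrite negbK => /eqP.
Qed.

(** The integrand is almost everywhere [1 + (ln lam)'], and [ln lam] is the
    integral of its derivative. *)
Lemma time_rescalingE (lam : R -> R) (t : R) :
  (forall s, 0 <= s -> 0 < lam s) ->
  (forall b, 0 < b -> exists2 k, 0 < k & lipschitz_itv b k (fun s => ln (lam s))) ->
  0 <= t -> time_rescaling lam t = t + (ln (lam t) - ln (lam 0)).
Proof.
move=> lam0 lnL; rewrite le_eqVlt => /predU1P[<-|t0].
  by rewrite /time_rescaling set_itv1 Rintegral_set1 subrr addr0.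
have t10 : 0 < t + 1 by rewrite addr_gt0.
have [k k0 lL] := lnL _ t10.
pose l := (fun s => ln (lam s)) \o clamp (t + 1).
have lE u : 0 <= u <= t -> l u = ln (lam u).
  by move=> /andP[u0 ut]; rewrite /l /= clamp_id// u0 (le_trans ut)// lerDl.
have [phi [mphi phik dphi phiE]] :=
  lipschitz_FTC k0 (lipschitz_clamp (ltW t10) k0 lL) t0.
rewrite -/l in dphi phiE.
have m1 : measurable_fun setT (fun u => 1 + phi u) by exact: measurable_funD.
have int1 : mu.-integrable `]0, t]%classic (EFin \o (fun u => 1 + phi u)).
  apply: (@bounded_itvoc_integrable _ _ (1 + k)) => // u.
  by rewrite (le_trans (ler_normD _ _))// normr1 lerD.
have -> : time_rescaling lam t = \int[mu]_(u in `[0, t]) (1 + phi u).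
  congr fine; apply: integral_ae_measurable => //.
    exact/measurable_EFinP/measurable_funTS.
  apply: filterS2 (ae_neq 0) dphi => u u0 du /=.
  rewrite in_itv/= le_eqVlt eq_sym (negbTE u0)/= => ut.
  have {}u0 : 0 < u by case/andP: ut.
  have [dl dlE] := du ut.
  have lamE : \near u, lam u = expR (l u).
    have : \forall z \near u, clamp (t + 1) z = z /\ 0 < z.
      apply: filterI; last exact: lt_nbhsr.
      by apply: near_clamp; rewrite u0 (le_lt_trans (andP ut).2)// ltrDl ltr01.
    apply: filterS => z [zE z0].
    by rewrite /l /= zE lnK// posrE lam0// ltW.
  have [_ dlam] : is_derive u 1 lam (lam u * phi u).
    have -> : lam u = expR (l u) by exact: nbhs_singleton lamE.
    apply: (@near_eq_is_derive _ _ _ (expR \o l)).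
      by apply: filterS lamE => z ->.
    apply: is_derive1_comp.
    by apply: DeriveDef => //; rewrite -derive1E.
  rewrite derive1E dlam; congr EFin.
  by field; rewrite gt_eqF// lam0// ltW.
rewrite -Rintegral_itv_obnd_cbnd// RintegralD//; last 2 first.
- by apply: (@bounded_itvoc_integrable _ _ 1) => // u; rewrite normr1.
- exact: (@bounded_itvoc_integrable _ _ k).
rewrite Rintegral_itvoc_cst ?(ltW t0)// mul1r subr0; congr (_ + _).
by rewrite -phiE ?lexx ?(ltW t0)// !lE ?lexx ?(ltW t0).
Qed.

Lemma expanding_pinv (tau : R -> R) (T := 'pinv_(fun=> 0) `[0, +oo[ tau) :
  tau 0 = 0 ->
  (forall s t, 0 <= s -> s <= t -> t - s <= tau t - tau s) ->
  (forall s, 0 <= s -> exists2 t, 0 <= t & tau t = s) ->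
  [/\ forall s, 0 <= s -> 0 <= T s <= s, forall s, 0 <= s -> tau (T s) = s &
    forall s t, 0 <= s -> 0 <= t -> `|T s - T t| <= `|s - t|].
Proof.
move=> tau0 tau_exp tau_surj.
have sj : set_surj `[0, +oo[ `[0, +oo[ tau.
  move=> s; rewrite /= in_itv/= andbT => /tau_surj[t t0 ts].
  by exists t => //; rewrite /= in_itv/= t0.
have tauT s : 0 <= s -> tau (T s) = s.
  by move=> s0; apply: (surjpK _ sj); rewrite inE/= in_itv/= s0.
have T0 s : 0 <= s -> 0 <= T s.
  move=> s0; have : `[0, +oo[%classic (T s).
    apply: (surjpinv_image_sub sj); exists s => //.
    by rewrite /= in_itv/= s0.
  by rewrite /= in_itv/= andbT.
split => // [s s0|s t].
  rewrite T0//=; have := tau_exp 0 (T s) (lexx 0) (T0 _ s0).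
  by rewrite tau0 !subr0 tauT.
wlog ts : s t / T t <= T s.
  move=> wl s0 t0; have [/wl|/ltW/wl] := leP (T t) (T s); first exact.
  by rewrite distrC [`|t - s|]distrC; exact.
move=> s0 t0; rewrite ger0_norm ?subr_ge0//.
rewrite (le_trans (tau_exp _ _ (T0 _ t0) ts))// !tauT//.
exact: ler_norm.
Qed.

End TimeRescaling.

Section NewtonEquation.
Variables (R : realType) (H : completeNormedModType R).
Variable dot : {dot H for @idfun R}.
Hypothesis dotE : induces_norm dot.

(** The identity [x (T z) = Y z + m z *: V z] is differentiated after taking the
    scalar product with the left-hand side of the conclusion, which is shown to
    have norm zero; only products and compositions of real functions then need
    to be differentiated. *)
Lemma newton_equation (x Y V : R -> H) (T m : R -> R) (c s : R) :
  is_derive (T s) 1 x (- (m s *: V s)) ->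
  (\forall z \near s, x (T z) = Y z + m z *: V z) ->
  (\forall z \near s, m z = c * expR (z - T z)) ->
  derivable Y s 1 -> derivable V s 1 -> derivable T s 1 -> m s != 0 ->
  (m s)^-1 *: derive1 Y s + derive1 V s + V s = 0.
Proof.
move=> dx xE mE dY dV dT ms0.
set Z := (X in X = 0); apply/eqP; rewrite -normr_eq0 -sqrf_eq0 dotE.
have isd (f : R -> H) : derivable f s 1 -> is_derive s 1 f (derive1 f s).
  by move=> df; apply: DeriveDef => //; rewrite derive1E.
have dT' : is_derive s 1 T (derive1 T s).
  by apply: DeriveDef => //; rewrite derive1E.
have dm : is_derive s 1 m (m s * (1 - derive1 T s)).
  have -> : m s = c * expR (s - T s) by exact: nbhs_singleton mE.
  apply: (@near_eq_is_derive _ _ _ (fun z => c * expR (z - T z))).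
    by apply: filterS mE => z ->.
  rewrite -mulrA.
  exact: (is_deriveZ c (is_derive1_comp (is_derive_expR _)
    (is_deriveB (is_derive_id s 1) dT'))).
pose w := Z.
have dxT : is_derive s 1 (fun z => dot (x (T z)) w)
    (dot (- (m s *: V s)) w * derive1 T s).
  apply: (@is_derive1_comp _ (fun z => dot (x z) w) T).
  exact: is_derive_dotl.
have dYV : is_derive s 1 (fun z => dot (x (T z)) w)
    (dot (derive1 Y s) w + (m s *: dot (derive1 V s) w +
      dot (V s) w *: (m s * (1 - derive1 T s)))).
  apply: (@near_eq_is_derive _ _ _
    (fun z => dot (Y z) w + m z * dot (V z) w)).
    by apply: filterS xE => z ->; rewrite dotDl dotZl.
  apply: is_deriveD; first exact/is_derive_dotl/isd.
  by apply: is_deriveM; exact/is_derive_dotl/isd.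
have := @derive_val _ _ _ _ _ _ _ dYV; rewrite (@derive_val _ _ _ _ _ _ _ dxT).
rewrite dotNl dotZl /GRing.scale/= => e.
have -> : dot Z Z = (m s)^-1 * (dot (derive1 Y s) w +
    m s * dot (derive1 V s) w + m s * dot (V s) w).
  rewrite {1}/Z !dotDl dotZl -/w; field.
  by [].
apply/eqP/(mulfI ms0); rewrite mulr0 mulrA divff// mul1r.
by move: e; lra.
Qed.

End NewtonEquation.

(** * The regularized Newton system *)

Lemma resolvent_value (R : realType) (H : completeNormedModType R)
    (A : H -> set H) (a : R) (z w : H) :
  a != 0 -> resolvent a A z = [set w] -> A w (a^-1 *: (z - w)).
Proof.
move=> a0 zw; have : resolvent a A z w by rewrite zw.
move=> [_ [_ [-> [u Au <-] ->]]].
by rewrite addrAC subrr add0r scalerA mulVf// scale1r.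
Qed.

Theorem theorem4p2 (R : realType) (H : completeNormedModType R)
    (dot : {dot H for @idfun R}) (A : H -> set H) (theta : R) (x0 : H)
    (x : R -> H) (lam : R -> R) (y v yt vt : R -> H) :
  induces_norm dot ->
  maximal_monotone dot A ->
  0 < theta ->
  ~ op_inv A 0 x0 ->
  closed_loop_solution A theta x0 x lam ->
  (forall t : R, 0 <= t -> resolvent (lam t) A (x t) = [set y t]) ->
  (forall t : R, 0 <= t -> v t = (lam t)^-1 *: (x t - y t)) ->
  (forall t : R, 0 <= t -> y t = yt (time_rescaling lam t)) ->
  (forall t : R, 0 <= t -> v t = vt (time_rescaling lam t)) ->
  regularized_newton_solution A (lam \o time_rescaling_inv lam) yt vt.
Proof.
move=> dotE [monoA _] theta0 _ [_ sol] yE vE ytE vtE.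
have lam0 t : 0 <= t -> 0 < lam t by move=> /sol[].
pose p t := (lam t)^-1.
have p0 t : 0 <= t -> 0 < p t by move=> t0; rewrite invr_gt0 lam0.
have pV t : (p t)^-1 = lam t by rewrite invrK.
have Av t : 0 <= t -> A (y t) (v t).
  move=> t0; rewrite vE//; apply: resolvent_value; last exact: yE.
  by rewrite gt_eqF// lam0.
have lamv t : 0 <= t -> lam t *: v t = x t - y t.
  by move=> t0; rewrite vE// scalerA divff ?scale1r// gt_eqF// lam0.
have xyv t : 0 <= t -> x t = y t + (p t)^-1 *: v t.
  by move=> t0; rewrite pV lamv// addrC subrK.
have vN t : 0 <= t -> `|v t| = theta * p t ^+ 2.
  move=> t0; have [l0 [x' [w [_ xw _ <-]]]] := sol t t0.
  have -> : w = y t by have : [set y t] w by rewrite -yE// xw.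
  rewrite vE// normrZ gtr0_norm ?invr_gt0// distrC /p.
  by field; rewrite gt_eqF.
have dx t : 0 <= t -> is_derive_halfline x t (- ((p t)^-1 *: v t)).
  move=> t0; have [l0 [x' [w [dx xw x'E _]]]] := sol t t0.
  have wy : w = y t by have : [set y t] w by rewrite -yE// xw.
  rewrite pV lamv// opprB -wy.
  by have -> : w - x t = x' by apply/eqP; rewrite subr_eq eq_sym -subr_eq0 x'E.
have mono s t : 0 <= s -> 0 <= t -> 0 <= dot (y s - y t) (v s - v t).
  by move=> s0 t0; apply: monoA; exact: Av.
have pb := p_bounds dotE theta0 p0 xyv vN mono dx.
have pdec := p_nonincreasing dotE theta0 p0 xyv vN mono dx.
have yL b : 0 < b -> exists2 k, 0 < k & lipschitz_itv b k y.
  move=> /pb[m [M [m0 M0 pmM]]].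
  exact: (y_lipschitz dotE theta0 p0 xyv vN mono dx m0 M0 pmM).
have vL b : 0 < b -> exists2 k, 0 < k & lipschitz_itv b k v.
  move=> /pb[m [M [m0 M0 pmM]]]; exists (2 * M * (theta * M)).
    by rewrite !mulr_gt0.
  exact: (v_lipschitz dotE theta0 p0 xyv vN mono dx M0 pmM).
have lnL b : 0 < b -> exists2 k, 0 < k & lipschitz_itv b k (fun s => ln (lam s)).
  move=> /pb[m [M [m0 M0 pmM]]]; exists (M / m); first by rewrite divr_gt0.
  have lnp := lnp_lipschitz dotE theta0 p0 xyv vN mono dx m0 M0 pmM.
  move=> s t sb tb; have [/andP[s0 _] /andP[t0 _]] := (sb, tb).
  have lnV u : 0 <= u -> ln (lam u) = - ln (p u).
    by move=> u0; rewrite -pV lnV ?posrE ?p0.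
  rewrite !lnV// opprK addrC distrC.
  exact: lnp.
pose tau := time_rescaling lam.
have tauE t : 0 <= t -> tau t = t + (ln (lam t) - ln (lam 0)).
  exact: time_rescalingE.
have tau0 : tau 0 = 0 by rewrite tauE// subrr addr0.
have tau_exp s t : 0 <= s -> s <= t -> t - s <= tau t - tau s.
  move=> s0 st; have t0 := le_trans s0 st.
  have : ln (lam s) <= ln (lam t).
    rewrite ler_ln ?posrE ?lam0// -[lam s]pV -[lam t]pV lef_pV2 ?posrE ?p0//.
    exact: pdec.
  by rewrite !tauE//; lra.
have tau_surj s : 0 <= s -> exists2 t, 0 <= t & tau t = s.
  rewrite le_eqVlt => /predU1P[<-|s0]; first by exists 0.
  have [k k0 lnk] := lnL s s0.
  pose l := (fun s => ln (lam s)) \o clamp s.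
  have lc : {within `[0, s], continuous (fun t => t + (l t - ln (lam 0)))}.
    apply: continuous_subspaceT => t; apply: cvgD; first exact: cvg_id.
    apply: cvgB; last exact: cvg_cst.
    exact: (lipschitz_real_continuous k0 (lipschitz_clamp (ltW s0) k0 lnk)).
  have lE t : 0 <= t <= s -> t + (l t - ln (lam 0)) = tau t.
    by move=> ts; rewrite /l /= clamp_id// tauE//; case/andP: ts.
  have [|t] := IVT (ltW s0) lc (v := s).
    rewrite !lE ?lexx ?(ltW s0)// tau0 ge_min le_max (ltW s0)/=.
    by have := tau_exp 0 s (lexx 0) (ltW s0); rewrite tau0 !subr0 => ->; rewrite orbT.
  rewrite in_itv/= => ts; rewrite lE// => tE.
  by exists t => //; case/andP: ts.
have [T0s tauT TL] := expanding_pinv tau0 tau_exp tau_surj.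
set T := 'pinv_(_) _ _ in T0s tauT TL.
have T0 s : 0 <= s -> 0 <= T s by move=> /T0s/andP[].
have ytT s : 0 <= s -> yt s = y (T s).
  by move=> s0; rewrite ytE ?T0// -/tau tauT.
have vtT s : 0 <= s -> vt s = v (T s).
  by move=> s0; rewrite vtE ?T0// -/tau tauT.
have compL (f g : R -> H) : (forall s, 0 <= s -> g s = f (T s)) ->
    (forall b, 0 < b -> exists2 k, 0 < k & lipschitz_itv b k f) ->
    forall b, 0 < b -> exists2 k, 0 < k & lipschitz_itv b k g.
  move=> gE fL b b0; have [k k0 fk] := fL b b0; exists k => // s t sb tb.
  have [/andP[s0 sb'] /andP[t0 tb']] := (sb, tb).
  have TLb u : 0 <= u -> u <= b -> 0 <= T u <= b.
    by move=> u0 ub; have /andP[-> /= Tu] := T0s u u0; rewrite (le_trans Tu).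
  rewrite !gE// (le_trans (fk _ _ _ _)) ?TLb//.
  by rewrite ler_pM2l// TL.
have ytL := compL _ _ ytT yL; have vtL := compL _ _ vtT vL.
have TLip b : 0 < b -> exists2 k, 0 < k & lipschitz_itv b k T.
  move=> b0; exists 1 => // s t /andP[s0 _] /andP[t0 _].
  by rewrite mul1r TL.
split.
- exact: lipschitz_itv_ac.
- exact: lipschitz_itv_ac.
- by move=> s s0; rewrite ytT// vtT//; exact/Av/T0.
have dyt := halfline_ae_derivable dotE ytL.
have dvt := halfline_ae_derivable dotE vtL.
have dT := halfline_ae_derivable_real TLip.
have dall : {ae @lebesgue_measure R, forall s, [/\ s != 0,
    0 < s -> derivable yt s 1, 0 < s -> derivable vt s 1 &
    0 < s -> derivable T s 1]}.
  by apply: filterS2 (ae_neq 0) (filterI dyt (filterI dvt dT)) => s s0 [? [? ?]].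
apply: filterS dall => s [sn0 dyts dvts dTs] s0.
have {sn0}s0 : 0 < s by rewrite lt_def sn0.
split; [exact: dyts|exact: dvts|].
(* so that the one-sided derivative of [x] at [T s] is an ordinary one *)
have Ts0 : 0 < T s.
  rewrite lt_def T0 ?ltW// andbT; apply/eqP => Ts.
  by move: (tauT s (ltW s0)); rewrite Ts tau0 => s00; rewrite -s00 ltxx in s0.
have near0 := lt_nbhsr s0.
apply: (newton_equation dotE (x := x) (T := T) (c := lam 0)) => //.
- rewrite /= vtT ?ltW// -pV; apply: halfline_is_derive => //.
  exact/dx/ltW.
- by apply: filterS near0 => z /ltW z0; rewrite ytT// vtT// /= -pV -xyv// T0.
- apply: filterS near0 => z /ltW z0 /=.
  have := tauT z z0; rewrite tauE ?T0// => zE.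
  have -> : z - T z = ln (lam (T z)) - ln (lam 0) by lra.
  rewrite expRD expRN !lnK ?posrE ?lam0 ?T0//.
  by field; rewrite gt_eqF// lam0.
- exact: dyts.
- exact: dvts.
- exact: dTs.
- by rewrite /= gt_eqF// lam0// T0// ltW.
Qed.
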